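(* Let $F$ be a closed relation on $2^\omega$ such that $\mathbb{B}_0\subseteq F\subseteq(N_0\times N_1)\cup(N_1\times N_0)$. (a) If $F$ is an Acyclic oriented graph, then there is an injective continuous $f:2^\omega\to2^\omega$ such that $(f\times f)[\mathbb{B}_0]\subseteq\mathbb{B}_0$, $(f\times f)[\overline{\mathbb{B}_0}\setminus\mathbb{B}_0]\subseteq\overline{\mathbb{B}_0}\setminus\mathbb{B}_0$ and $(f\times f)[\neg\overline{\mathbb{B}_0}]\subseteq\neg F$. (b) If $F$ is an acyclic graph, then there is an injective continuous $f:2^\omega\to2^\omega$ such that $(f\times f)[\mathbb{B}_0]\subseteq\mathbb{B}_0$, $(f\times f)[\overline{\mathbb{B}_0}\setminus\mathbb{B}_0]\subseteq\overline{\mathbb{B}_0}\setminus\mathbb{B}_0$ and $(f\times f)[\neg s(\overline{\mathbb{B}_0})]\subseteq\neg F$.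
   Context: $N_s:=\{\alpha\in2^\omega\mid s\subseteq\alpha\}$; $\neg$ denotes complement in $2^\omega\times2^\omega$; $\overline{E}$ is the closure; $s(E):=E\cup E^{-1}$. Graph = irreflexive symmetric relation; oriented graph = irreflexive relation with $E\cap E^{-1}$ contained in the diagonal. $E$ is acyclic if there is no injective sequence $(x_i)_{i\le n}$, $n\ge2$, with $(x_i,x_{i+1})\in E$ for $i<n$ and $(x_n,x_0)\in E$; Acyclic means $s(E)$ acyclic. Let $\psi:\omega\to2^{<\omega}$ list finite binary sequences by increasing length and lexicographically within each length, $s_n:=\psi(n)0^{n-|\psi(n)|}$, $\mathbb{G}_0:=\{(s_n0\gamma,s_n1\gamma)\mid n\in\omega,\gamma\in2^\omega\}$, $\mathbb{B}_0:=\{(0\alpha,1\beta)\mid(\alpha,\beta)\in\mathbb{G}_0\}$. *)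

(* Defs.v *)
From mathcomp Require Import all_boot.
From mathcomp Require Import all_classical topology cantor.

Set Implicit Arguments.
Unset Strict Implicit.
Unset Printing Implicit Defensive.

Local Open Scope classical_set_scope.
Local Open Scope relation_scope.

(* A relation on X is a set of pairs; E^-1 (relation_scope) is its inverse. *)

Definition symmetrization (X : Type) (E : set (X * X)) : set (X * X) :=
  E `|` E^-1.

Definition irreflexive_rel (X : Type) (E : set (X * X)) : Prop :=
  forall x : X, ~ E (x, x).

Definition symmetric_rel (X : Type) (E : set (X * X)) : Prop :=
  forall x y : X, E (x, y) -> E (y, x).

Definition is_graph (X : Type) (E : set (X * X)) : Prop :=
  irreflexive_rel E /\ symmetric_rel E.

Definition is_oriented_graph (X : Type) (E : set (X * X)) : Prop :=
  irreflexive_rel E /\ E `&` E^-1 `<=` diagonal.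

(* The finite sequence (x_i)_(i <= n) is the restriction to {0, ..., n} of
   x : nat -> X; only these values are constrained. *)
Definition is_acyclic (X : Type) (E : set (X * X)) : Prop :=
  ~ exists n : nat, exists x : nat -> X,
      [/\ 2 <= n,
          {in [pred i | i <= n] &, injective x},
          forall i : nat, i < n -> E (x i, x i.+1)
        & E (x n, x 0)].

Definition is_Acyclic (X : Type) (E : set (X * X)) : Prop :=
  is_acyclic (symmetrization E).

(* The concatenation s gamma. *)
Definition scat (s : seq bool) (gamma : cantor_space) : cantor_space :=
  fun k => if k < size s then nth false s k else gamma (k - size s).

(* The basic clopen set N_s. *)
Definition cylinder (s : seq bool) : set cantor_space :=
  [set alpha | forall k : nat, k < size s -> alpha k = nth false s k].

(* The words of length k, in lexicographic order. *)
Fixpoint words (k : nat) : seq (seq bool) :=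
  if k is k'.+1 then
    [seq false :: w | w <- words k'] ++ [seq true :: w | w <- words k']
  else [:: [::]].

(* There are 2 ^ n.+1 - 1 > n words of length at most n, so the default value
   of nth is never used. *)
Definition psi (n : nat) : seq bool :=
  nth [::] (flatten [seq words k | k <- iota 0 n.+1]) n.

(* size (psi n) <= n, so the truncated subtraction is exact. *)
Definition s_ (n : nat) : seq bool := psi n ++ nseq (n - size (psi n)) false.

Definition G0 : set (cantor_space * cantor_space) :=
  [set p | exists (n : nat) (gamma : cantor_space),
     p = (scat (rcons (s_ n) false) gamma, scat (rcons (s_ n) true) gamma)].

Definition B0 : set (cantor_space * cantor_space) :=
  [set p | exists (alpha beta : cantor_space),
     G0 (alpha, beta) /\ p = (scat [:: false] alpha, scat [:: true] beta)].

(* Main.v *)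
(* Write G for the union of G0 and the diagonal; closure B0 is the set of pairs
   (0x, 1y) with (x, y) in G.  Replacing F by F `|` F^-1 reduces (a) to the
   symmetric case, so let F be symmetric and acyclic, and let R be the set of
   (x, y) with (0x, 1y) in F, a closed set containing G.  Two points that agree
   from some coordinate on are joined by a path of G0-edges, so acyclicity
   forces such a pair to be in R only if it is in G.

   The reduction is f(bx) = b h(x) with h(x) = 0^m0 x_0 0^m1 x_1 ..., the bit
   x_n being put at position L n.  The word h(s_n)0^m is some s_k for arbitrarily
   large m, so the L n can be chosen such that h is a homomorphism of G0.  If x
   and y differ at two coordinates below n, then the prefixes of h(x) and h(y) of
   length L n, continued by zeros, are eventually equal and not in G, hence not
   in R; as R is closed, taking L n large enough puts (h(x), h(y)) outside R.  If
   x and y differ at exactly one coordinate, then h(x) and h(y) are themselves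
   eventually equal, so (h(x), h(y)) in R implies (h(x), h(y)) in G and then
   (x, y) in G. *)
Require Import Defs.
From mathcomp Require Import all_boot.
From mathcomp Require Import all_classical unstable topology cantor.

Local Open Scope classical_set_scope.

(** * Topology of the Cantor space through common prefixes *)

Definition agree (N : nat) (x y : cantor_space) : Prop :=
  forall k, k < N -> x k = y k.

Lemma agree_leq {M N x y} : M <= N -> agree N x y -> agree M x y.
Proof. by move=> MN + k kM; apply; exact: leq_trans MN. Qed.

Lemma nbhs_agree N (x : cantor_space) : nbhs x (agree N x).
Proof.
elim: N => [|N IHN].
  by apply: filterS filterT => y _ k; rewrite ltn0.
have xN : nbhs x (proj N @^-1` [set x N]).
  exact: (@proj_continuous nat (fun=> bool) N x _ (discrete_set1 _)).
apply: filterS (filterI IHN xN) => y [xy /= yN] k.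
by rewrite ltnS leq_eqVlt => /predU1P[->|/xy].
Qed.

(** The product topology is a supremum over the coordinates, so it is enough that the filter of
    prefix agreement converges in each coordinate. *)
Lemma nbhsP_agree (x : cantor_space) (U : set cantor_space) :
  nbhs x U -> exists N, agree N x `<=` U.
Proof.
move=> xU.
have agree_filter : Filter (filter_from [set: nat] (agree^~ x)).
  apply: filter_from_filter; first by exists 0.
  move=> i j _ _; exists (maxn i j) => // y yx.
  by split; apply: agree_leq yx; rewrite ?leq_maxl ?leq_maxr.
suff : filter_from [set: nat] (agree^~ x) --> (x : prod_topology (fun=> bool)).
  by move=> /(_ U xU) [N _ NU]; exists N.
apply/cvg_sup => i V [W] [[O oO <-] Oi WV].
exists i.+1 => // y yx; apply: WV.
by rewrite /= -yx; [exact: Oi|exact: ltnSn].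
Qed.

Lemma closure_agree (C : set (cantor_space * cantor_space)) x y :
  closure C (x, y) <->
  forall N, exists x' y', [/\ C (x', y'), agree N x x' & agree N y y'].
Proof.
split=> [Cxy N|Cxy V [[A B] /= [/nbhsP_agree[M MA] /nbhsP_agree[N NB]] ABV]].
  have /Cxy[[x' y'] [Cx'y' [/= xx' yy']]] :
      nbhs (x, y) (agree N x `*` agree N y).
    by exists (agree N x, agree N y) => //; split; exact: nbhs_agree.
  by exists x', y'.
have [x' [y' [Cx'y' xx' yy']]] := Cxy (maxn M N).
exists (x', y'); split => //; apply: ABV; split => /=.
- by apply: MA; apply: agree_leq xx'; exact: leq_maxl.
- by apply: NB; apply: agree_leq yy'; exact: leq_maxr.
Qed.

Lemma continuous_agree (f : cantor_space -> cantor_space) :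
  (forall x N, exists M, forall y, agree M x y -> agree N (f x) (f y)) ->
  continuous f.
Proof.
move=> fP x U /nbhsP_agree[N NU]; have [M xM] := fP x N.
by apply: filterS (nbhs_agree M x) => y /xM /NU.
Qed.

(** * The enumeration of words and the density of the [s_ n] *)

Lemma size_words {k w} : w \in words k -> size w = k.
Proof.
elim: k w => [|k IHk] w /=; first by rewrite inE => /eqP->.
by rewrite mem_cat => /orP[] /mapP[v /IHk sv ->] /=; rewrite sv.
Qed.

Lemma mem_words w : w \in words (size w).
Proof.
elim: w => [|b w IHw] //=; rewrite mem_cat.
by case: b; rewrite map_f ?orbT.
Qed.

Definition words_upto n := flatten [seq words k | k <- iota 0 n.+1].

Lemma words_uptoS n : words_upto n.+1 = words_upto n ++ words n.+1.
Proof. by rewrite /words_upto -addn1 iotaD map_cat flatten_cat /= cats0. Qed.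

Lemma words_upto_leq {m n} : m <= n -> prefix (words_upto m) (words_upto n).
Proof.
move=> /subnKC <-; elim: (n - m) => [|d IHd]; first by rewrite addn0 prefix_refl.
by rewrite addnS words_uptoS; apply: prefix_trans IHd (prefix_prefix _ _).
Qed.

Lemma ltn_size_words_upto n : n < size (words_upto n).
Proof.
elim: n => [|n IHn] //; rewrite words_uptoS size_cat.
have : nseq n.+1 false \in words n.+1.
  by rewrite -[in words _](size_nseq n.+1 false) mem_words.
by case: (words n.+1) => // w s _; rewrite /= addnS ltnS (leq_trans IHn) ?leq_addr.
Qed.

Lemma psi_surj w : exists n, psi n = w.
Proof.
pose W := words_upto (size w).
have wW : w \in W.
  apply/flatten_mapP; exists (size w); rewrite ?mem_words //.
  by rewrite mem_iota /=  ltnS.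
exists (index w W); rewrite -[RHS](nth_index [::] wW) /psi -/(words_upto _).
(* [psi n] reads the list up to length [n], the index of [w] refers to the list up to [size w]; the
   shorter list is a prefix of the longer. *)
have nthp (s t : seq (seq bool)) i : prefix s t -> i < size s ->
    nth [::] t i = nth [::] s i.
  by move=> /prefixP[u ->] si; rewrite nth_cat si.
have [wi|iw] := leqP (size w) (index w W).
  by rewrite (nthp _ _ _ (words_upto_leq wi)) ?index_mem.
by rewrite (nthp _ _ _ (words_upto_leq (ltnW iw))) ?ltn_size_words_upto.
Qed.

Lemma size_psi n : size (psi n) <= n.
Proof.
rewrite /psi -/(words_upto n).
have /(mem_nth [::]) /flatten_mapP[k] := ltn_size_words_upto n.
by rewrite mem_iota /= add0n ltnS => kn /size_words ->.
Qed.

Lemma size_s_ n : size (s_ n) = n.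
Proof. by rewrite size_cat size_nseq subnKC ?size_psi. Qed.

Lemma nth_nseq0 n i : nth false (nseq n false) i = false.
Proof. by rewrite nth_nseq if_same. Qed.

(** Take [psi k] to be [u] followed by [M] zeros: [s_ k] only appends zeros. The default [false]
    stands for zeros past the end of either word. *)
Lemma s_dense u M :
  exists k, [/\ M <= k, size u <= k
    & forall i, nth false (s_ k) i = nth false u i].
Proof.
have [k kE] := psi_surj (u ++ nseq M false).
have := size_psi k; rewrite kE size_cat size_nseq => kge.
exists k; split.
- by apply: leq_trans kge; exact: leq_addl.
- by apply: leq_trans kge; exact: leq_addr.
- move=> i; rewrite /s_ kE -catA nth_cat; case: ltnP => // ui.
  by rewrite nth_cat !nth_nseq0 if_same nth_default.
Qed.

(** * [G0], its union with the diagonal, and the closure of [B0] in coordinates *)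

Lemma G0P (x y : cantor_space) : G0 (x, y) <->
  exists n, [/\ x n = false, y n = true,
    forall k, k < n -> x k = nth false (s_ n) k
    & forall k, k != n -> x k = y k].
Proof.
split=> [[n [g [-> ->]]]|[n [xn yn xs xy]]].
  exists n; rewrite /scat !size_rcons !size_s_ ltnSn !nth_rcons !size_s_ ltnn eqxx.
  split=> // k kn; first by rewrite ltnS (ltnW kn) nth_rcons size_s_ kn.
  by rewrite !nth_rcons !size_s_ (negbTE kn).
exists n, (fun k => x (k + n.+1)); congr pair; apply/funext => k;
  rewrite /scat size_rcons nth_rcons size_s_ ltnS leq_eqVlt; case: eqP => [->|/eqP kn] /=.
- by rewrite ltnn.
- by case: ltnP => [/xs//|nk]; rewrite subnK // ltn_neqAle eq_sym kn.
- by rewrite ltnn.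
- by rewrite -xy //; case: ltnP => [/xs//|nk]; rewrite subnK // ltn_neqAle eq_sym kn.
Qed.

Definition G0r : set (cantor_space * cantor_space) :=
  [set p | p.1 = p.2 \/ G0 p].

(** In this form each instance in [i] and [k] concerns finitely many coordinates, hence passes to
    limits. *)
Lemma G0rP (x y : cantor_space) : G0r (x, y) <->
  forall i, x i <> y i -> [/\ x i = false, y i = true,
    forall k, k < i -> x k = nth false (s_ i) k
    & forall k, k != i -> x k = y k].
Proof.
split=> [[/= -> //|/G0P[n [xn yn xs xy]] i xyi]|H].
  have -> : i = n by apply: contra_notP xyi => /eqP; exact: xy.
  by [].
case: (pselect (x = y)) => [xy|xy]; [by left|right].
have [i /H ?] : exists i, x i <> y i.
  by apply/existsNP => xyE; apply/xy/funext.
by apply/G0P; exists i.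
Qed.

Lemma scat1S b (x : cantor_space) k : scat [:: b] x k.+1 = x k.
Proof. by rewrite /scat /= subn1. Qed.

Definition tail (a : cantor_space) : cantor_space := fun k => a k.+1.

Lemma scat_tail (a : cantor_space) : scat [:: a 0] (tail a) = a.
Proof. by apply/funext => -[|k] //; rewrite scat1S. Qed.

Lemma tail_scat b (x : cantor_space) : tail (scat [:: b] x) = x.
Proof. by apply/funext => k; rewrite /tail scat1S. Qed.

Lemma B0P (x y : cantor_space) :
  B0 (scat [:: false] x, scat [:: true] y) <-> G0 (x, y).
Proof.
split=> [[x' [y' [G [/(congr1 tail) + /(congr1 tail)]]]]|G]; last by exists x, y.
by rewrite !tail_scat => -> ->.
Qed.

Lemma closure_B0P (a b : cantor_space) : closure B0 (a, b) <->
  [/\ a 0 = false, b 0 = true & G0r (tail a, tail b)].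
Proof.
split=> [/closure_agree Cab|].
  have apx N : exists x y, [/\ G0 (x, y), agree N.+1 a (scat [:: false] x)
                             & agree N.+1 b (scat [:: true] y)].
    by have [_ [_ [[x [y [Gxy [-> ->]]]] ax yb]]] := Cab N.+1; exists x, y.
  split; first by have [x [y [_ /(_ 0) ->]]] := apx 0.
    by have [x [y [_ _ /(_ 0) ->]]] := apx 0.
  apply/G0rP => i abi.
  have apxi j : exists x y, [/\ G0r (x, y),
      forall k, k <= maxn i j -> x k = tail a k
      & forall k, k <= maxn i j -> y k = tail b k].
    have [x [y [Gxy ax yb]]] := apx (maxn i j).+1; exists x, y; split.
    - by right.
    - by move=> k kij; rewrite /tail ax ?scat1S.
    - by move=> k kij; rewrite /tail yb ?scat1S.
  have apxP j : [/\ tail a i = false, tail b i = true,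
      j < i -> tail a j = nth false (s_ i) j & j != i -> tail a j = tail b j].
    have [x [y [/G0rP Gxy ax yb]]] := apxi j.
    have [] := Gxy i; first by rewrite ax ?yb ?leq_maxl.
    rewrite ax ?yb ?leq_maxl // => -> -> xs xy; split=> // ji.
      by rewrite -ax ?leq_maxr ?xs.
    by rewrite -ax ?leq_maxr // -yb ?leq_maxr // xy.
  by have [? ? _ _] := apxP 0; split=> // k; have [] := apxP k.
move=> [a0 b0] []; rewrite -(scat_tail a) -(scat_tail b) a0 b0 !tail_scat; last first.
  by move=> /B0P; exact: subset_closure.
move=> /= <-; apply/closure_agree => N.
(* A diagonal pair is approximated by a [G0]-edge whose word [s_ k] extends the first [N] bits; as
   [N <= k], the differing bit comes too late to be seen. *)
have [k [Nk _ skE]] := s_dense (mkseq (tail a) N) N.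
pose z c := scat (rcons (s_ k) c) (tail a).
exists (scat [:: false] (z false)), (scat [:: true] (z true)); split.
- by apply/B0P; exists k, (tail a).
all: move=> [|j] jN //; rewrite !scat1S /z /scat size_rcons size_s_.
all: rewrite ltnS nth_rcons size_s_ (ltnW (leq_trans (ltnW jN) Nk)).
all: by rewrite (leq_trans (ltnW jN) Nk) skE nth_mkseq // ltnW.
Qed.

(** * Paths in acyclic graphs *)

Section AcyclicGraph.
Variables (T : eqType) (F : set (T * T)).
Hypotheses (F_sym : symmetric_rel F) (F_acyclic : is_acyclic F).

(** Once repetitions are removed, a path with at least two edges would be closed into a cycle by the
    edge between its ends. *)
Lemma acyclic_path_edge (e : rel T) a p : (forall x y, e x y -> F (x, y)) ->
  path e a p -> a <> last a p -> F (a, last a p) -> e a (last a p).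
Proof.
move=> eF /shortenP[[|b [|c q]] //= eq uq _ _ Fa]; first by case/andP: eq.
case: F_acyclic; exists (size q).+2, (nth a [:: a, b, c & q]); split=> //.
- by move=> i j; rewrite !inE => iq jq /eqP; rewrite nth_uniq //= => /eqP.
- by move=> i iq; apply: eF; have /(pathP a) : path e a [:: b, c & q] := eq; apply.
- by move/F_sym: Fa; rewrite -[last c q]/(last a [:: b, c & q]) (last_nth a).
Qed.

End AcyclicGraph.

Definition tail_equal (x y : cantor_space) : Prop :=
  exists n, forall k, n <= k -> x k = y k.

(** Taking the closure adds the edges between [0x] and [1x], which let a path change sides while
    keeping [x]. *)
Definition B0_edge a b := `[< symmetrization (closure B0) (a, b) >].

Lemma G0r_edge x y : G0r (x, y) ->
  B0_edge (scat [:: false] x) (scat [:: true] y)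
  /\ B0_edge (scat [:: true] y) (scat [:: false] x).
Proof.
by move=> Gxy; split; apply/asboolP; [left|right];
  apply/closure_B0P; rewrite !tail_scat.
Qed.

Lemma tail_equal_path x y : tail_equal x y ->
  exists2 p, path B0_edge (scat [:: false] x) p
           & last (scat [:: false] x) p = scat [:: false] y.
Proof.
move=> [n]; elim: n x y => [|n IHn] x y xy.
  by exists [::] => //=; congr scat; apply/funext => k; exact: xy.
have [xyn|xyn] := eqVneq (x n) (y n).
  apply: IHn => k; rewrite leq_eqVlt => /predU1P[<-//|]; exact: xy.
(* The [G0]-edge at coordinate [n]: beyond [n] its ends follow [x], so the induction hypothesis
   joins [x] to [z (x n)] and [z (y n)] to [y]. *)
pose z b : cantor_space :=
  fun k => if k < n then nth false (s_ n) k else if k == n then b else x k.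
have Gz : G0 (z false, z true).
  apply/G0P; exists n; rewrite /z ltnn eqxx; split=> // k; first by move=> ->.
  by move=> /negbTE ->.
have [p xp zp] : exists2 p, path B0_edge (scat [:: false] x) p
    & last (scat [:: false] x) p = scat [:: false] (z (x n)).
  apply: IHn => k nk; rewrite /z ltnNge nk /=.
  by case: eqP => // ->.
have [q yq zq] : exists2 p, path B0_edge (scat [:: false] (z (y n))) p
    & last (scat [:: false] (z (y n))) p = scat [:: false] y.
  apply: IHn => k nk; rewrite /z ltnNge nk /=.
  by case: eqP => [->//|/eqP kn]; rewrite xy // ltn_neqAle eq_sym kn.
have [z01 z10] := G0r_edge _ _ (or_intror Gz : G0r (z false, z true)).
have [z11 z11'] := G0r_edge _ _ (or_introl erefl : G0r (z true, z true)).
(* In either direction the crossing passes through [1 z(true)], using one [G0]-edge and one diagonal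
   edge. *)
exists (p ++ [:: scat [:: true] (z true), scat [:: false] (z (y n)) & q]).
  rewrite cat_path xp zp /= yq.
  by move: xyn; case: (x n); case: (y n) => // _; rewrite ?z01 ?z10 ?z11 ?z11'.
by rewrite last_cat.
Qed.

(** * The closed relation [R] and the choice of the positions *)

Section Reduction.
Variable F : set (cantor_space * cantor_space).
Hypotheses (F_closed : closed F) (B0_sub_F : B0 `<=` F).
Hypotheses (F_sym : symmetric_rel F) (F_acyclic : is_acyclic F).

Let R : set (cantor_space * cantor_space) :=
  [set p | F (scat [:: false] p.1, scat [:: true] p.2)].

Lemma closure_B0_sub : closure B0 `<=` F.
Proof. by rewrite (closure_id F).1 //; exact: closureS. Qed.

(** Extending the path from [0x] to [0y] by the edge to [1y] makes [acyclic_path_edge] applicable;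
    first bits exclude the reverse orientation. *)
Lemma tail_equal_G0r x y : tail_equal x y -> R (x, y) -> G0r (x, y).
Proof.
move=> xy Rxy.
have [p xp py] := tail_equal_path _ _ xy.
have [yy _] := G0r_edge _ _ (or_introl erefl : G0r (y, y)).
have pxy : path B0_edge (scat [:: false] x) (rcons p (scat [:: true] y)).
  by rewrite rcons_path xp py.
have /asboolP[] : B0_edge (scat [:: false] x) (scat [:: true] y).
- have := acyclic_path_edge _ F F_sym F_acyclic B0_edge _ _ _ pxy.
  rewrite last_rcons; apply => //.
  + by move=> a b /asboolP[/closure_B0_sub//|/closure_B0_sub/F_sym].
  + by move=> /(congr1 (fun a : cantor_space => a 0)).
- by move=> /closure_B0P[_ _]; rewrite !tail_scat.
- by move=> /closure_B0P[].
Qed.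

Lemma R_open x y : ~ R (x, y) -> exists N, forall x' y',
  agree N x x' -> agree N y y' -> ~ R (x', y').
Proof.
move=> nR; apply/not_existsP => apx; apply: nR.
apply: F_closed; apply/closure_agree => N.
have /existsNP[x' /existsNP[y' /not_implyP[xx' /not_implyP[yy' /contrapT Rxy]]]] := apx N.
exists (scat [:: false] x'), (scat [:: true] y'); split=> //.
- by move=> [|k] kN //; rewrite !scat1S /= xx' // ltnW.
- by move=> [|k] kN //; rewrite !scat1S /= yy' // ltnW.
Qed.

(* The bits of s placed at the positions listed in l, and 0 elsewhere. *)
Definition spread (l : seq nat) (s : seq bool) : cantor_space :=
  fun k => nth false s (index k l).

Lemma spread_notin l s k : size s <= size l -> k \notin l ->
  spread l s k = false.
Proof. by move=> sl /memNindex kl; rewrite /spread kl nth_default. Qed.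

(** With [l] the positions chosen so far, [m] is the next one. There are finitely many pairs of
    words of length [size l], so one bound serves them all. *)
Lemma spread_step (l : seq nat) : exists m, [/\ forall i, i \in l -> i < m,
    forall k, spread l (s_ (size l)) k = nth false (s_ m) k
  & forall s t x y, size s = size l -> size t = size l ->
      agree m (spread l s) x -> agree m (spread l t) y ->
      R (x, y) -> R (spread l s, spread l t)].
Proof.
have Nex (p : (size l).-tuple bool * (size l).-tuple bool) : exists n,
    forall x y, agree n (spread l p.1) x -> agree n (spread l p.2) y ->
    R (x, y) -> R (spread l p.1, spread l p.2).
  have [Rp|/R_open[n nP]] := pselect (R (spread l p.1, spread l p.2)).
    by exists 0.
  by exists n => x y px py /(nP _ _ px py).
have [N NP] := fin_all_exists Nex.
(* [M] also exceeds every position in [l], so cutting the spread word at [M] loses only zeros. *)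
pose M := maxn (\max_p N p) (\max_(i <- l) i.+1).
have [m [Mm _ mE]] := s_dense (mkseq (spread l (s_ (size l))) M) M.
have lM i : i \in l -> i < M.
  by move=> il; rewrite leq_max; apply/orP; right; exact: (@leq_bigmax_seq _ l xpredT succn).
exists m; split.
- by move=> i /lM iM; exact: leq_trans Mm.
- move=> k; rewrite mE; case: (ltnP k M) => kM; first by rewrite nth_mkseq.
  rewrite [RHS]nth_default ?size_mkseq // spread_notin ?size_s_ //.
  by apply: contraL kM => /lM; rewrite -ltnNge.
- move=> s t x y /eqP ss /eqP st sx ty.
  have Nm : N (Tuple ss, Tuple st) <= m.
    by apply: leq_trans Mm; rewrite leq_max leq_bigmax.
  by apply: (NP (Tuple ss, Tuple st)); [exact: agree_leq sx|exact: agree_leq ty].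
Qed.

Lemma positions : exists L : nat -> nat, forall n,
  [/\ forall i, i < n -> L i < L n,
    forall k, spread (mkseq L n) (s_ n) k = nth false (s_ (L n)) k
  & forall s t x y, size s = n -> size t = n ->
      agree (L n) (spread (mkseq L n) s) x ->
      agree (L n) (spread (mkseq L n) t) y ->
      R (x, y) -> R (spread (mkseq L n) s, spread (mkseq L n) t)].
Proof.
have [m mP] := choice spread_step.
pose ls n := iter n (fun l => rcons l (m l)) [::].
exists (m \o ls) => n.
have lsE : mkseq (m \o ls) n = ls n by elim: n => // n IHn; rewrite mkseqS IHn.
have [/= ml mE mR] := mP (ls n).
have sls : size (ls n) = n by rewrite -lsE size_mkseq.
rewrite lsE; split.
- by move=> i ni; apply: ml; rewrite -lsE; apply/mapP; exists i; rewrite ?mem_iota.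
- by move=> k; rewrite -mE sls.
- by move=> s t x y ss st; apply: mR; rewrite ?sls.
Qed.

End Reduction.

(** * The map [h] and the reduction [f] built from it *)

Section Interleave.
Variables (L : nat -> nat) (L_lt : forall i j, i < j -> L i < L j).

(** For increasing [L], [n <= L n], so only [L 0], ..., [L k] can equal [k] and a finite word
    suffices at coordinate [k]. *)
Definition interleave (x : cantor_space) : cantor_space :=
  fun k => spread (mkseq L k.+1) (mkseq x k.+1) k.

Lemma L_inj : injective L.
Proof. by move=> i j Lij; case: (ltngtP i j) => // /L_lt; rewrite Lij ltnn. Qed.

Lemma leq_L n : n <= L n.
Proof. by elim: n => // n IHn; apply: leq_ltn_trans IHn _; exact: L_lt. Qed.

Lemma spread_mkseq n s i : i < n -> spread (mkseq L n) s (L i) = nth false s i.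
Proof.
move=> ni; rewrite /spread index_map; last exact: L_inj.
by rewrite -[X in index X](nth_iota 0 0 ni) index_uniq ?size_iota ?iota_uniq.
Qed.

Lemma interleave_L x n : interleave x (L n) = x n.
Proof. by rewrite /interleave spread_mkseq ?nth_mkseq ?ltnS ?leq_L. Qed.

Lemma interleave_notin x k : (forall n, L n <> k) -> interleave x k = false.
Proof.
move=> Lk; rewrite /interleave spread_notin ?size_mkseq //.
by apply/mapP => -[n _ kE]; exact: (Lk n).
Qed.

Lemma interleave_spread n x :
  agree (L n) (spread (mkseq L n) (mkseq x n)) (interleave x).
Proof.
move=> k kn; have [[i iE]|/forallNP Lk] := pselect (exists i, L i = k).
  have ni : i < n by rewrite ltnNge; apply: contraL kn => /=;
    rewrite -iE -leqNgt leq_eqVlt => /predU1P[->//|/L_lt/ltnW].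
  by rewrite -iE interleave_L spread_mkseq // nth_mkseq.
rewrite interleave_notin // spread_notin ?size_mkseq //.
by apply/mapP => -[i _ kE]; exact: (Lk i).
Qed.

Lemma interleave_neq x y k : interleave x k <> interleave y k ->
  exists2 n, k = L n & x n <> y n.
Proof.
have [[i <-]|/forallNP Lk] := pselect (exists i, L i = k).
  by rewrite !interleave_L; exists i.
by rewrite !interleave_notin.
Qed.

(** The differing coordinate moves from [n] to [L n], and the hypothesis says that the image of
    [s_ n] continues as [s_ (L n)]. *)
Lemma interleave_G0 x y :
  (forall n k, spread (mkseq L n) (s_ n) k = nth false (s_ (L n)) k) ->
  G0 (x, y) -> G0 (interleave x, interleave y).
Proof.
move=> Ls /G0P[n [xn yn xs xy]]; apply/G0P; exists (L n).
rewrite !interleave_L; split=> // [k kn|k kn].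
  rewrite -(interleave_spread n) // -Ls; congr (spread _ _ k).
  apply: (@eq_from_nth _ false); rewrite size_mkseq ?size_s_ // => i ni.
  by rewrite nth_mkseq // xs.
apply: contrapT => /interleave_neq[i kE]; apply; apply: xy.
by apply: contraNneq kn => <-; rewrite kE.
Qed.

Definition lift_interleave (a : cantor_space) : cantor_space :=
  scat [:: a 0] (interleave (tail a)).

Lemma lift_interleave_inj : injective lift_interleave.
Proof.
move=> a b ab; rewrite -(scat_tail a) -(scat_tail b).
congr scat; first by rewrite -[a 0]/(lift_interleave a 0) ab.
apply/funext => n; rewrite -[LHS]interleave_L -[RHS]interleave_L.
by rewrite -[interleave _](tail_scat (a 0)) -/(lift_interleave a) ab tail_scat.
Qed.

Lemma lift_interleave_continuous : continuous lift_interleave.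
Proof.
apply: continuous_agree => a N; exists N.+1 => b ab [|k] kN.
  exact: ab.
rewrite /lift_interleave !scat1S /interleave; congr (spread _ _ k).
apply/eq_in_map => i; rewrite mem_iota /= add0n => ik.
by apply: ab; rewrite ltnS (leq_trans ik) // ltnW.
Qed.

Lemma lift_interleave_scat b x :
  lift_interleave (scat [:: b] x) = scat [:: b] (interleave x).
Proof. by rewrite /lift_interleave tail_scat. Qed.

End Interleave.

(** * The symmetric case and the two statements *)

Lemma closure_B0_diff a b : (closure B0 `\` B0) (a, b) <->
  exists x, a = scat [:: false] x /\ b = scat [:: true] x.
Proof.
split=> [[/closure_B0P[a0 b0 [/= ab|Gab]] nB]|[x [-> ->]]].
- by exists (tail a); rewrite -{1}(scat_tail a) -{1}(scat_tail b) a0 b0 ab.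
- by case: nB; rewrite -(scat_tail a) -(scat_tail b) a0 b0; apply/B0P.
split; first by apply/closure_B0P; rewrite !tail_scat; split => //; left.
by move=> /B0P/G0P[n [-> ]].
Qed.

Lemma reduction (F : set (cantor_space * cantor_space)) :
  closed F -> B0 `<=` F -> symmetric_rel F -> is_acyclic F ->
  F `<=` (cylinder [:: false] `*` cylinder [:: true])
                `|` (cylinder [:: true] `*` cylinder [:: false]) ->
  exists f : cantor_space -> cantor_space,
    [/\ injective f /\ continuous f,
        map_pair f @` B0 `<=` B0,
        map_pair f @` (closure B0 `\` B0) `<=` closure B0 `\` B0
      & forall a b, F (f a, f b) -> symmetrization (closure B0) (a, b)].
Proof.
move=> F_closed B0_sub_F F_sym F_acyclic F_sub.
have [L LP] := positions F F_closed.
have L_lt i j : i < j -> L i < L j by have [+ _ _] := LP j; apply.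
have Ls n k : spread (mkseq L n) (s_ n) k = nth false (s_ (L n)) k.
  by have [_ + _] := LP n; apply.
have RG x y : F (scat [:: false] (interleave L x), scat [:: true] (interleave L y)) ->
    G0r (x, y).
  move=> Rxy; apply/G0rP => i xyi.
  have G0r_of := tail_equal_G0r F F_closed B0_sub_F F_sym F_acyclic.
  have [[j ji xyj]|xy] := pselect (exists2 j, j != i & x j <> y j).
    pose n := (maxn i j).+1.
    have [ni nj] : i < n /\ j < n by rewrite !ltnS leq_maxl leq_maxr.
    have [_ _ /(_ (mkseq x n) (mkseq y n) _ _ _ _ (interleave_spread _ L_lt _ _)
      (interleave_spread _ L_lt _ _) Rxy)] := LP n.
    rewrite !size_mkseq => /(_ erefl erefl) /G0r_of/G0rP/(_ (L i))[].
    - exists (L n) => k nk.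
      have kL : k \notin mkseq L n.
        apply: contraL nk => /mapP[m]; rewrite mem_iota /= add0n => mn ->.
        by rewrite -ltnNge L_lt.
      by rewrite !spread_notin ?size_mkseq.
    - by rewrite !spread_mkseq // !nth_mkseq.
    (* A pair in [G0r] differs in at most one coordinate, but these two differ at both [L i] and
       [L j]. *)
    - move=> _ _ _ /(_ (L j)); rewrite !spread_mkseq // !nth_mkseq // => eq.
      by case: xyj; apply: eq; apply: contra_neq ji; exact: L_inj.
  have {}xy k : k != i -> x k = y k.
    by move=> ki; apply: contrapT => xyk; apply: xy; exists k.
  have /G0r_of/(_ Rxy)/G0rP/(_ (L i)) : tail_equal (interleave L x) (interleave L y).
    exists (L i).+1 => k ik; apply: contrapT => /(interleave_neq _ L_lt)[m kE]; apply.
    by apply: xy; apply: contraTneq ik => mi; rewrite kE mi ltnn.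
  rewrite !interleave_L // => /(_ xyi)[xi yi xs _]; split=> // k ki.
  (* Reading [s_ (L i)] at position [L k] returns bit [k] of [s_ i]. *)
  by rewrite -(interleave_L _ L_lt x) xs ?L_lt // -Ls spread_mkseq.
exists (lift_interleave L); split.
- by split; [exact: lift_interleave_inj|exact: lift_interleave_continuous].
- move=> _ [_ [x [y [Gxy ->]]] <-] /=.
  by rewrite /map_pair /= !lift_interleave_scat; apply/B0P/interleave_G0.
- move=> _ [[a b] /closure_B0_diff[x [-> ->]] <-].
  by apply/closure_B0_diff; exists (interleave L x); rewrite !lift_interleave_scat.
- move=> a b Fab; case: (F_sub _ Fab) => -[/= /(_ 0 isT) a0 /(_ 0 isT) b0].
    left; apply/closure_B0P; split=> //; apply: RG.
    by move: Fab; rewrite /lift_interleave [a 0]a0 [b 0]b0.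
  right; apply/closure_B0P; split=> //; apply: RG; apply: F_sym.
  by move: Fab; rewrite /lift_interleave [a 0]a0 [b 0]b0.
Qed.

Lemma closed_symmetrization (F : set (cantor_space * cantor_space)) :
  closed F -> closed (symmetrization F).
Proof.
move=> cF; apply: closedU => // -[a b] /closure_agree Fab; apply: cF.
apply/closure_agree => N; have [x [y [Fxy ax yb]]] := Fab N.
by exists y, x.
Qed.

Theorem theorem4p11 (F : set (cantor_space * cantor_space))
    (F_closed : closed F)
    (B0_sub_F : B0 `<=` F)
    (F_sub : F `<=` (cylinder [:: false] `*` cylinder [:: true])
                `|` (cylinder [:: true] `*` cylinder [:: false])) :
  (is_oriented_graph F -> is_Acyclic F ->
     exists f : cantor_space -> cantor_space,
       [/\ injective f, continuous f,
           map_pair f @` B0 `<=` B0,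
           map_pair f @` (closure B0 `\` B0) `<=` closure B0 `\` B0
         & map_pair f @` (~` closure B0) `<=` ~` F])
  /\
  (is_graph F -> is_acyclic F ->
     exists f : cantor_space -> cantor_space,
       [/\ injective f, continuous f,
           map_pair f @` B0 `<=` B0,
           map_pair f @` (closure B0 `\` B0) `<=` closure B0 `\` B0
         & map_pair f @` (~` symmetrization (closure B0)) `<=` ~` F]).
Proof.
split=> [[F_irr F_anti] F_acyclic|[_ F_sym] F_acyclic].
  have [||||f [[f_inj f_cont] fB0 fclB0 fF]] := reduction (symmetrization F) _ _ _ F_acyclic.
  - exact: closed_symmetrization.
  - by move=> p /B0_sub_F; left.
  - by move=> x y [|] ?; [right|left].
  - by move=> [a b] [|] /F_sub[] [? ?]; [left|right|right|left].
  exists f; split=> // _ [[a b] nab <-] Fab; case: (fF a b); first by left.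
    exact: nab.
  move=> ba.
  (* The reverse orientation remains to be excluded: [f] preserves [B0] and the rest of its closure,
     so [F] would contain the image pair in both orientations, against antisymmetry and
     irreflexivity. *)
  have Fba : F (f b, f a).
    have clF : closure B0 `<=` F by exact: closure_B0_sub.
    have [Bba|nBba] := pselect (B0 (b, a)).
      by apply/B0_sub_F/fB0; exists (b, a).
    by apply: clF; have [] : (closure B0 `\` B0) (f b, f a)
      by apply: fclB0; exists (b, a).
  have /diagonalP fab : diagonal (f a, f b) by apply: F_anti; split.
  by apply: (F_irr (f a)); rewrite {2}fab.
have [f [[f_inj f_cont] fB0 fclB0 fF]] :=
  reduction F F_closed B0_sub_F F_sym F_acyclic F_sub.
by exists f; split=> // _ [[a b] nab <-] /fF.
Qed.
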